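(* Let $S$ be a compact oriented surface with negative Euler characteristic, with a pants decomposition $C_1$ and dual graph $G_1$, and consider an $\mathrm{SL}(2,\mathbb{C})$-representation of $\pi_1(S)$ satisfying (C1) and (C2), with chosen eigenvalue parameters. Apply a right Dehn twist to the dual graph at an interior edge of $G_1$ with eigenvalue and twist parameters $(e_i,t_i)$. Then the new parameters of this edge are $$(e_i',t_i')=(e_i,\ e_i^2t_i).$$
   Context: Pants decomposition: a disjoint union of simple closed curves cutting $S$ into pairs of pants; a pants curve is one of these curves or a boundary component of $S$. Dual graph: a graph embedded in $S$, all edges oriented, with only trivalent and univalent vertices, one trivalent vertex in each pair of pants, one univalent vertex on each component of $\partial S$, interior edges (both ends trivalent) crossing the pants decomposition exactly once transversely, boundary edges not crossing it. Edges correspond to pants curves. (C1): the image of each pants curve has exactly two fixed points on $\mathbb{C}P^1$. (C2): the restriction of $\rho$ to $\pi_1$ of each pair of pants is irreducible (no common fixed point in $\mathbb{C}P^1$). Eigenvalue parameter of an edge: a chosen eigenvalue of $\rho$ of the corresponding pants curve. Twist parameter: let $f$ be an interior edge from $v$ to $v'$, with base point on $f$ at the crossing with the pants curve $c$. Let $(f,h_2,h_3)$ be the half-edges at $v$ in counterclockwise order starting with the initial half of $f$, and $(f,h_4,h_5)$ those at $v'$ in counterclockwise order starting with the terminal half of $f$. For $i=2,3$ (resp. $4,5$), $\gamma_i$ is the loop going along $f$ to $v$ (resp. $v'$), along $h_i$ to the corresponding boundary component of the pair of pants, once around it counterclockwise (hole on the left) and back; $\gamma_1$ is the analogous loop around $c$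 seen from $v$; then $\gamma_1\gamma_2\gamma_3=1=\gamma_1^{-1}\gamma_4\gamma_5$. For $i\ge2$, $x_i\in\mathbb{C}P^1$ is the fixed point of $\rho(\gamma_i)$ given by the eigenvector for the eigenvalue parameter $e$ of the edge containing $h_i$ if $h_i$ is outgoing, and for $e^{-1}$ if $h_i$ is incoming; $x_1,y_1$ are the fixed points of $\rho(\gamma_1)$ for $e_f,e_f^{-1}$. The twist parameter $t_f\in\mathbb{C}^*$ is the unique number such that the matrix with eigenvalue $\sqrt{-t_f}$ at $x_1$ and $1/\sqrt{-t_f}$ at $y_1$ sends $x_2$ to $x_5$. Right Dehn twist at $f$: the dual graph is replaced by its image under the Dehn twist along $c$ for which an arc crossing $c$ turns right when approaching $c$. On the loops above (base point taken on the $v'$-side of the twisting annulus) it replaces $(\gamma_1,\gamma_2,\gamma_3,\gamma_4,\gamma_5)$ by $(\gamma_1,\gamma_1^{-1}\gamma_2\gamma_1,\gamma_1^{-1}\gamma_3\gamma_1,\gamma_4,\gamma_5)$. *)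

(* Defs.v *)
From HB Require Import structures.
From mathcomp Require Import all_boot all_order all_algebra complex.
From mathcomp Require Import all_classical all_reals all_analysis.
Set Implicit Arguments.
Unset Strict Implicit.
Unset Printing Implicit Defensive.
Import Order.TTheory GRing.Theory Num.Theory.
Import numFieldNormedType.Exports.
Local Open Scope classical_set_scope.
Local Open Scope ring_scope.

(** * Paths and the fundamental group *)

(* A path is a function on R of which only the restriction to [0, 1] matters. *)
Definition is_path (R : realType) (T : topologicalType) (x y : T) (g : R -> T) :
    Prop :=
  [/\ {within `[0, 1], continuous g}, g 0 = x & g 1 = y].

Definition is_loop (R : realType) (T : topologicalType) (b : T) (g : R -> T) :
    Prop :=
  is_path b b g.

(* Products of paths are read from left to right: [g1] is travelled first. *)
Definition path_mul (R : realType) (T : Type) (g1 g2 : R -> T) : R -> T :=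
  fun s => if s <= 2^-1 then g1 (2 * s) else g2 (2 * s - 1).

Definition path_inv (R : realType) (T : Type) (g : R -> T) : R -> T :=
  fun s => g (1 - s).

(* Go along [q], run through the loop [g], come back along [q]. *)
Definition lasso (R : realType) (T : Type) (q g : R -> T) : R -> T :=
  path_mul q (path_mul g (path_inv q)).

Definition path_homotopic (R : realType) (T : topologicalType) (x y : T)
    (g g' : R -> T) : Prop :=
  exists H : R * R -> T,
    [/\ {within `[0, 1] `*` `[0, 1], continuous H},
        forall s, 0 <= s <= 1 -> H (s, 0) = g s,
        forall s, 0 <= s <= 1 -> H (s, 1) = g' s &
        forall u, 0 <= u <= 1 -> H (0, u) = x /\ H (1, u) = y].

(* A homomorphism pi_1(T, b) -> SL(2, C), given by its values on loops. *)
Definition SL2_representation (R : realType) (T : topologicalType) (b : T)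
    (rho : (R -> T) -> 'M[complex R]_2) : Prop :=
  [/\ forall g, is_loop b g -> \det (rho g) = 1,
      forall g g', is_loop b g -> is_loop b g' ->
        path_homotopic b b g g' -> rho g = rho g' &
      forall g g', is_loop b g -> is_loop b g' ->
        rho (path_mul g g') = rho g *m rho g'].

(** * The action of SL(2, C) on the projective line *)

(* Points of CP^1 are given by homogeneous coordinates, that is, nonzero
   column vectors up to [same_point]. *)
Definition same_point (C : fieldType) (x y : 'cV[C]_2) : Prop :=
  exists2 c : C, c != 0 & y = c *: x.

Definition fixes_point (C : fieldType) (A : 'M[C]_2) (x : 'cV[C]_2) : Prop :=
  same_point x (A *m x).

Definition exactly_two_fixed_points (C : fieldType) (A : 'M[C]_2) : Prop :=
  exists x y : 'cV[C]_2,
    [/\ x != 0 /\ y != 0, ~ same_point x y, fixes_point A x, fixes_point A y &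
        forall z : 'cV[C]_2, z != 0 -> fixes_point A z ->
          same_point x z \/ same_point y z].

Definition eigenvector (C : fieldType) (A : 'M[C]_2) (a : C) (x : 'cV[C]_2) :
    Prop :=
  x != 0 /\ A *m x = a *: x.

(** * The standard pair of pants and its tripod *)

(* The standard pair of pants is the unit sphere of R^3, oriented by the outward
   normal, minus three open caps centred at the vectors e_0, e_1, e_2 of the
   canonical basis.  Indices are cyclic, and (e_i, e_{i+1}, e_{i+2}) is a direct
   basis; [axis_point i h a b] is h e_i + a e_{i+1} + b e_{i+2}. *)
Definition axis_point (R : realType) (i : 'I_3) (h a b : R) : 'rV[R]_3 :=
  \row_j (if j == i then h else if j == ordS i then a else b).

Definition std_pants (R : realType) : set 'rV[R]_3 :=
  [set x | \sum_j x 0 j ^+ 2 = 1 /\ forall j, x 0 j <= 4 / 5].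

Definition std_cuff (R : realType) (i : 'I_3) : set 'rV[R]_3 :=
  [set x | std_pants x /\ x 0 i = 4 / 5].

(* The circle [std_cuff i] travelled once, counterclockwise around the hole at
   e_i seen from outside the sphere (the hole is on the left). *)
Definition cuff_loop (R : realType) (i : 'I_3) (s : R) : 'rV[R]_3 :=
  axis_point i (4 / 5) (3 / 5 * cos (pi / 4 + 2 * pi * s))
                       (3 / 5 * sin (pi / 4 + 2 * pi * s)).

Definition std_center (R : realType) : 'rV[R]_3 := const_mx (Num.sqrt 3)^-1.

(* The arc of great circle from [std_center] to [cuff_loop i 0].  The legs
   0, 1, 2 leave [std_center] in counterclockwise order. *)
Definition std_leg (R : realType) (i : 'I_3) (s : R) : 'rV[R]_3 :=
  let h := (1 - s) / Num.sqrt 3 + s * (4 / 5) in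
  let w := Num.sqrt ((1 - h ^+ 2) / 2) in
  axis_point i h w w.

(* The loop based at the end of leg [i] that goes along leg [i] to the centre,
   along leg [k] to the cuff [k], once around it with the hole on the left, and
   back. *)
Definition std_loop (R : realType) (i k : 'I_3) : R -> 'rV[R]_3 :=
  lasso (path_mul (path_inv (std_leg i)) (std_leg k)) (cuff_loop k).

(* The Dehn twist of the standard pair of pants supported in the collar
   7/10 <= x_i <= 4/5 of the cuff [i].  The rotation angle around e_i increases
   from 0 to 2 pi as one approaches the cuff, so that an arc approaching the
   cuff turns right, that is, goes around with the hole on its left.  It is the
   identity on the three cuffs. *)
Definition std_twist (R : realType) (i : 'I_3) (x : 'rV[R]_3) : 'rV[R]_3 :=
  let th := 2 * pi * Num.max 0 (10 * x 0 i - 7) in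
  let a := x 0 (ordS i) in
  let b := x 0 (ord_pred i) in
  axis_point i (x 0 i) (cos th * a - sin th * b) (sin th * a + cos th * b).

(** * Surfaces with a pants decomposition and a dual graph *)

(* A pants decomposition of S with a dual graph is given by parametrizations
   [chart v] of its pairs of pants by the standard one that carry the standard
   tripod onto the part of the dual graph inside them.  Trivalent vertices of
   the dual graph are identified with pairs of pants; half-edges (v, i)
   correspond to the legs of the tripods.  [glue] maps a half-edge to the other
   half of its edge; it fixes the half-edges of boundary edges (those that end
   on the boundary of S).  [outgoing] gives the orientation of the edges. *)
Record pants_marking (R : realType) (S : topologicalType) := PantsMarking {
  vertex : finType;
  chart : vertex -> 'rV[R]_3 -> S;
  glue : vertex * 'I_3 -> vertex * 'I_3;
  outgoing : pred (vertex * 'I_3)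
}.

Definition half_edge (R : realType) (S : topologicalType)
    (D : pants_marking R S) : Type := (vertex D * 'I_3)%type.

Definition interior_edge (R : realType) (S : topologicalType)
    (D : pants_marking R S) (h : half_edge D) : bool := glue h != h.

(* The pants curve at [h], as a loop with the hole of the pair of pants of [h]
   on its left, starting at the end of the half-edge. *)
Definition curve_loop (R : realType) (S : topologicalType)
    (D : pants_marking R S) (h : half_edge D) : R -> S :=
  chart h.1 \o cuff_loop h.2.

Definition pants_curve (R : realType) (S : topologicalType)
    (D : pants_marking R S) (h : half_edge D) : set S :=
  chart h.1 @` std_cuff h.2.

(* The point where the edge of [h] meets the pants curve. *)
Definition crossing (R : realType) (S : topologicalType)
    (D : pants_marking R S) (h : half_edge D) : S := curve_loop h 0.

(* S is the compact surface obtained from disjoint copies of the standard pair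
   of pants by gluing the cuffs of the two halves of each interior edge.  The
   gluing homeomorphisms reverse the boundary orientation, so that the
   orientations of the copies define one of S, and match the ends of the legs.
   Compactness of S follows, and S has the quotient topology as it is Hausdorff. *)
Definition decomposed_surface (R : realType) (S : topologicalType)
    (D : pants_marking R S) : Prop :=
  [/\ hausdorff_space S /\ connected [set: S],
      involutive (@glue R S D) /\
        (forall h : half_edge D, interior_edge h ->
           outgoing (glue h) = ~~ outgoing h),
      (forall v : vertex D, {within @std_pants R, continuous (chart v)}) /\
        \bigcup_(v in [set: vertex D]) chart v @` std_pants (R := R) = [set: S],
      forall h : half_edge D, interior_edge h ->
        exists g : R -> R,
          [/\ {within `[0, 1], continuous g},
              {in `[0, 1] &, forall s s', s < s' -> g s' < g s},
              g 0 = 1, g 1 = 0 &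
              forall s, 0 <= s <= 1 -> curve_loop h s = curve_loop (glue h) (g s)] &
      forall (v w : vertex D) (x y : 'rV[R]_3), std_pants x -> std_pants y ->
        chart v x = chart w y ->
        (v = w /\ x = y) \/
        exists i j : 'I_3,
          [/\ interior_edge ((v, i) : half_edge D), glue (v, i) = (w, j),
              std_cuff i x & std_cuff j y]].

(* Each pair of pants has Euler characteristic -1, each pants curve 0. *)
Definition euler_characteristic (R : realType) (S : topologicalType)
    (D : pants_marking R S) : int := - #|vertex D|%:Z.

(* The right Dehn twist along the pants curve of [h], supported in a collar of
   this curve inside the pair of pants of [h].  It fixes all pants curves
   pointwise and the other pairs of pants, so that the images of the dual graph
   and of the parametrizations are obtained by changing the single chart of the
   pair of pants of [h].  The crossing point of the edge of [h], used as a base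
   point, lies on the [glue h]-side of the twisting annulus. *)
Definition right_dehn_twist (R : realType) (S : topologicalType)
    (D : pants_marking R S) (h : half_edge D) : pants_marking R S :=
  PantsMarking
    (fun v x => if v == h.1 then chart v (std_twist h.2 x) else chart v x)
    (@glue R S D) (@outgoing R S D).

(** * Parameters of representations *)

Definition curves_have_two_fixed_points (R : realType) (S : topologicalType)
    (D : pants_marking R S) (b : S) (rho : (R -> S) -> 'M[complex R]_2) : Prop :=
  forall (h : half_edge D) (q : R -> S), is_path b (crossing h) q ->
    exactly_two_fixed_points (rho (lasso q (curve_loop h))).

Definition irreducible_on_pants (R : realType) (S : topologicalType)
    (D : pants_marking R S) (b : S) (rho : (R -> S) -> 'M[complex R]_2) : Prop :=
  forall (v : vertex D) (q : R -> S), is_path b (chart v (@std_center R)) q ->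
    ~ exists2 x : 'cV[complex R]_2, x != 0 &
        forall g : R -> 'rV[R]_3, is_loop (@std_center R) g ->
          (forall s, 0 <= s <= 1 -> std_pants (g s)) ->
          fixes_point (rho (lasso q (chart v \o g))) x.

(* Eigenvalue parameters are attached to pants curves, seen as subsets of S:
   [ev c] is the chosen eigenvalue of the curve [c] (the eigenvalues of a matrix
   in SL(2, C) and of its inverse are the same). *)
Definition eigenvalue_parameters (R : realType) (S : topologicalType)
    (D : pants_marking R S) (b : S) (rho : (R -> S) -> 'M[complex R]_2)
    (ev : set S -> complex R) : Prop :=
  forall (h : half_edge D) (q : R -> S), is_path b (crossing h) q ->
    eigenvalue (rho (lasso q (curve_loop h))) (ev (pants_curve h)).

Definition oriented_parameter (R : realType) (S : topologicalType)
    (D : pants_marking R S) (ev : set S -> complex R)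
    (h : half_edge D) : complex R :=
  if outgoing h then ev (pants_curve h) else (ev (pants_curve h))^-1.

(* The loop from the crossing point of the edge of [h] that goes along [h] to
   its vertex, along its [k]-th half-edge and around the pants curve there. *)
Definition vertex_loop (R : realType) (S : topologicalType)
    (D : pants_marking R S) (h : half_edge D) (k : 'I_3) : R -> S :=
  chart h.1 \o std_loop h.2 k.

(* Here [f] is the initial half of an interior edge and [rho] is a representation
   of pi_1(S, crossing f).  With h3 and h4 the remaining half-edges and gamma3,
   gamma4 their loops, (f, h2, h3) and (f', h4, h5) are in counterclockwise order
   and gamma1 gamma2 gamma3 = 1 = gamma1^-1 gamma4 gamma5.  The vectors x1, y1,
   x2, x5 represent fixed points of the images of gamma1, gamma1, gamma2,
   gamma5. *)
Definition twist_condition (R : realType) (S : topologicalType)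
    (D : pants_marking R S) (rho : (R -> S) -> 'M[complex R]_2)
    (ev : set S -> complex R) (f : half_edge D) (t : complex R) : Prop :=
  let f' : half_edge D := glue f in
  let gamma1 := curve_loop f in
  let h2 : half_edge D := (f.1, ordS f.2) in
  let gamma2 := vertex_loop f h2.2 in
  let h5 : half_edge D := (f'.1, ord_pred f'.2) in
  let gamma5 := vertex_loop f' h5.2 in
  let e := ev (pants_curve f) in
  t != 0 /\
  exists (M : 'M[complex R]_2) (x1 y1 x2 x5 : 'cV[complex R]_2),
    [/\ eigenvector (rho gamma1) e x1,
        eigenvector (rho gamma1) e^-1 y1,
        eigenvector (rho gamma2) (oriented_parameter ev h2) x2 &
        eigenvector (rho gamma5) (oriented_parameter ev h5) x5] /\
    [/\ M *m x1 = sqrtC (- t) *: x1,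
        M *m y1 = (sqrtC (- t))^-1 *: y1 &
        same_point (M *m x2) x5].

Definition twist_parameter (R : realType) (S : topologicalType)
    (D : pants_marking R S) (rho : (R -> S) -> 'M[complex R]_2)
    (ev : set S -> complex R) (f : half_edge D) (t : complex R) : Prop :=
  unique (twist_condition rho ev f) t.

Definition edge_parameters (R : realType) (S : topologicalType)
    (D : pants_marking R S) (rho : (R -> S) -> 'M[complex R]_2)
    (ev : set S -> complex R) (f : half_edge D) (p : complex R * complex R) : Prop :=
  p.1 = ev (pants_curve f) /\ twist_parameter rho ev f p.2.

Arguments edge_parameters {R S} D rho ev f p.

(* Main.v *)
Require Import Defs.
From HB Require Import structures.
From mathcomp Require Import all_boot all_order all_algebra complex.
From mathcomp Require Import all_classical all_reals all_analysis.
From mathcomp Require Import ring lra.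
Import Order.TTheory GRing.Theory Num.Theory.
Import numFieldNormedType.Exports.
Local Open Scope classical_set_scope.
Local Open Scope ring_scope.

(* Rotating the collar of the twist by a growing fraction of the full angle is a
   free homotopy from gamma2 to its image, whose base point runs once along
   gamma1; hence the image of gamma2 is conjugate to gamma2 by gamma1.  The same
   homotopy fixes the base point of gamma5, seen from the other side of the pants
   curve, even if both sides lie in the same pair of pants.  If A is the image of
   gamma1, the point x2 is therefore replaced by A^-1 x2, which M A sends to x5
   if M sends x2 to x5; as A has the eigenvalues e at x1 and 1/e at y1, the
   square root of -t is multiplied by e, up to a sign that acts trivially on
   the projective line. *)

(** * Continuity of composite and coordinatewise maps *)

Lemma continuous_within_comp (T U V : topologicalType) (A : set T) (B : set U)
    (f : T -> U) (g : U -> V) :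
  continuous f -> (forall x, A x -> B (f x)) -> {within B, continuous g} ->
  {within A, continuous (g \o f)}.
Proof.
move=> cf fAB /subspace_continuousP cg; apply/subspace_continuousP => x Ax W nW.
have := cf x _ (cg _ (fAB _ Ax) W nW).
by apply: (@filterS _ (nbhs x)) => y /= + Ay; apply; exact: fAB.
Qed.

Lemma continuous_pair (T U V : topologicalType) (f : T -> U) (g : T -> V) :
  continuous f -> continuous g -> continuous (fun x => (f x, g x)).
Proof. by move=> cf cg x; apply: cvg_pair; [exact: cf|exact: cg]. Qed.

(** A neighbourhood of a matrix contains a product of neighbourhoods of its entries, and there are
    only finitely many entries to control. *)
Lemma continuous_mx (T U : topologicalType) (m n : nat) (f : T -> 'M[U]_(m, n)) :
  (forall i j, continuous (fun x => f x i j)) -> continuous f.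
Proof.
move=> cf x W [P nP PW].
apply: (@filterS _ (nbhs x) _ (fun y => forall i j, P i j (f y i j))).
  by move=> y Py; apply: PW => i j; exact: Py.
apply: filter_forall => i; apply: filter_forall => j.
exact: cf (nP i j).
Qed.

Lemma continuous_fun_add (R : realType) (T : topologicalType)
    (V : normedModType R) (f g : T -> V) :
  continuous f -> continuous g -> continuous (fun x => f x + g x).
Proof. by move=> cf cg x; exact: (continuousD (cf x) (cg x)). Qed.

Lemma continuous_fun_sub (R : realType) (T : topologicalType)
    (V : normedModType R) (f g : T -> V) :
  continuous f -> continuous g -> continuous (fun x => f x - g x).
Proof. by move=> cf cg x; exact: (continuousB (cf x) (cg x)). Qed.

Lemma continuous_fun_mul (R : realType) (T : topologicalType) (f g : T -> R) :
  continuous f -> continuous g -> continuous (fun x => f x * g x).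
Proof. by move=> cf cg x; exact: (continuousM (cf x) (cg x)). Qed.

Lemma continuous_fun_max (R : realType) (T : topologicalType) (f g : T -> R) :
  continuous f -> continuous g -> continuous (fun x => Num.max (f x) (g x)).
Proof. by move=> cf cg x; exact: (continuous_max (cf x) (cg x)). Qed.

Lemma continuous_fun_min (R : realType) (T : topologicalType) (f g : T -> R) :
  continuous f -> continuous g -> continuous (fun x => Num.min (f x) (g x)).
Proof. by move=> cf cg x; exact: (continuous_min (cf x) (cg x)). Qed.

Lemma continuous_fun_comp (T U V : topologicalType) (f : T -> U) (g : U -> V) :
  continuous f -> continuous g -> continuous (fun x => g (f x)).
Proof. by move=> cf cg x; exact: (continuous_comp (cf x) (cg (f x))). Qed.

(** * Homotopies of paths and free homotopies of loops *)

Lemma continuous_within_slice (R : realType) (T : topologicalType)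
    (H : R * R -> T) (u : R) :
  {within `[0, 1] `*` `[0, 1], continuous H} -> 0 <= u <= 1 ->
  {within `[0, 1], continuous (fun s => H (s, u))}.
Proof.
move=> cH u01.
apply: (@continuous_within_comp _ _ _ _ _ (fun s => (s, u)) H _ _ cH).
  by apply: continuous_pair => s; [exact: cvg_id|exact: cst_continuous].
by move=> s s01; split => //=; rewrite in_itv.
Qed.

(* The boundary of the square [0, 1]^2 is contracted along straight segments. *)
Lemma path_homotopic_square (R : realType) (T : topologicalType)
    (H : R * R -> T) :
  {within `[0, 1] `*` `[0, 1], continuous H} ->
  path_homotopic (H (0, 0)) (H (1, 1))
    (path_mul (fun s => H (s, 0)) (fun u => H (1, u)))
    (path_mul (fun u => H (0, u)) (fun s => H (s, 1))).
Proof.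
move=> cH.
(* The point [(a s, b s)] runs along the bottom side and then the right side, [(b s, a s)] along the
   left side and then the top side. [F] joins the two by segments, which stay in the square by
   convexity. *)
pose a (s : R) := Num.min 1 (2 * s); pose b (s : R) := Num.max 0 (2 * s - 1).
pose F (p : R * R) := ((1 - p.2) * a p.1 + p.2 * b p.1,
                       (1 - p.2) * b p.1 + p.2 * a p.1).
have cf : continuous (fun p : R * R => p.1) by move=> p; exact: cvg_fst.
have cs : continuous (fun p : R * R => p.2) by move=> p; exact: cvg_snd.
have cst (k : R) : continuous (fun _ : R * R => k) by exact: cst_continuous.
have ca : continuous (fun p : R * R => a p.1).
  by apply: continuous_fun_min => //; apply: continuous_fun_mul.
have cb : continuous (fun p : R * R => b p.1).
  apply: continuous_fun_max => //; apply: continuous_fun_sub => //.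
  exact: continuous_fun_mul.
have ct : continuous (fun p : R * R => 1 - p.2).
  exact: continuous_fun_sub.
have cF : continuous F.
  by apply: continuous_pair; apply: continuous_fun_add; apply: continuous_fun_mul.
have a0 : a 0 = 0 by rewrite /a mulr0 min_r.
have b0 : b 0 = 0 by rewrite /b mulr0 sub0r max_l// lerN10.
have a1 : a 1 = 1 by rewrite /a min_l//; lra.
have b1 : b 1 = 1 by rewrite /b max_r; lra.
exists (H \o F); split.
- apply: continuous_within_comp cF _ cH => -[s u] [/=].
  rewrite !in_itv/= => /andP[s0 s1] /andP[u0 u1].
  have as0 : 0 <= a s by rewrite /a le_min; apply/andP; split; lra.
  have as1 : a s <= 1 by rewrite /a ge_min lexx.
  have bs0 : 0 <= b s by rewrite /b le_max lexx.
  have bs1 : b s <= 1 by rewrite /b ge_max; apply/andP; split; lra.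
  by split=> /=; apply/andP; split; nra.
- move=> s _; rewrite /F/= /path_mul subr0 !mul1r !mul0r !addr0 /a /b.
  case: ifP => [s2|/negbT]; last rewrite -ltNge => s2.
    by rewrite min_r ?max_l//; lra.
  by rewrite min_l ?max_r//; lra.
- move=> s _; rewrite /F/= /path_mul subrr !mul1r !mul0r !add0r /a /b.
  case: ifP => [s2|/negbT]; last rewrite -ltNge => s2.
    by rewrite min_r ?max_l//; lra.
  by rewrite min_l ?max_r//; lra.
(* Both routes start at (0, 0) and end at (1, 1), so the segments between their ends are
   constant. *)
- by move=> u _; rewrite /F/= a0 b0 a1 b1 !mulr0 !mulr1 !addr0 subrK.
Qed.

(** Both paths are horizontal slices of a map continuous on the square. This recovers the loop
    hypotheses under which a representation respects homotopy. *)
Lemma path_homotopic_is_path (R : realType) (T : topologicalType) (x y : T)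
    (g g' : R -> T) :
  path_homotopic x y g g' -> is_path x y g /\ is_path x y g'.
Proof.
move=> [H [cH Hg Hg' Hxy]].
have I0 : 0 <= (0 : R) <= 1 by rewrite lexx ler01.
have I1 : 0 <= (1 : R) <= 1 by rewrite ler01 lexx.
have sub u k : 0 <= u <= 1 -> (forall s, 0 <= s <= 1 -> H (s, u) = k s) ->
    is_path x y k.
  move=> u01 Hk; split; rewrite -?Hk//; try by case: (Hxy u u01).
  (* The slice and [k] are known to agree on [0, 1] only. *)
  apply: (@subspace_eq_continuous _ _ _ (fun s => H (s, u))).
    by move=> s; rewrite inE /= in_itv/= => /Hk.
  exact: continuous_within_slice.
by split; [exact: sub Hg|exact: sub Hg'].
Qed.

(* Freely homotopic loops are conjugate by the track of the base point. *)
Lemma representation_free_homotopy (R : realType) (T : topologicalType) (b : T)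
    (rho : (R -> T) -> 'M[complex R]_2) (H : R * R -> T) (g g' c : R -> T) :
  SL2_representation b rho ->
  {within `[0, 1] `*` `[0, 1], continuous H} ->
  (forall s, H (s, 0) = g s) -> (forall s, H (s, 1) = g' s) ->
  (forall u, H (0, u) = c u) -> (forall u, H (1, u) = c u) ->
  is_loop b c ->
  [/\ is_loop b g, is_loop b g' & rho g *m rho c = rho c *m rho g'].
Proof.
move=> [_ rhoh rhoM] cH Hg Hg' H0 H1 lc; have [cc c0 c1] := lc.
have lg : is_loop b g.
  rewrite -(funext Hg); split; rewrite ?H0 ?H1//.
  by apply: continuous_within_slice cH _; rewrite lexx ler01.
have lg' : is_loop b g'.
  rewrite -(funext Hg'); split; rewrite ?H0 ?H1//.
  by apply: continuous_within_slice cH _; rewrite lexx ler01.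
split=> //.
have : path_homotopic b b (path_mul g c) (path_mul c g').
  have := path_homotopic_square _ _ _ cH.
  rewrite (_ : (fun s => H (s, 0)) = g); last exact/funext.
  rewrite (_ : (fun s => H (s, 1)) = g'); last exact/funext.
  rewrite (_ : (fun u => H (0, u)) = c); last exact/funext.
  rewrite (_ : (fun u => H (1, u)) = c); last exact/funext.
  by rewrite H0 H1 c0 c1.
by move=> /[dup] /path_homotopic_is_path[lgc lcg'] /rhoh; rewrite !rhoM//; exact.
Qed.

(** * Products of paths and lassos *)

Lemma path_mul0 (R : realType) (T : Type) (g g' : R -> T) :
  path_mul g g' 0 = g 0.
Proof. by rewrite /path_mul invr_ge0 ler0n mulr0. Qed.

Lemma path_mul1 (R : realType) (T : Type) (g g' : R -> T) :
  path_mul g g' 1 = g' 1.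
Proof.
rewrite /path_mul ifF; last by apply/negbTE; rewrite -ltNge; lra.
by congr g'; lra.
Qed.

Lemma lasso0 (R : realType) (T : Type) (q g : R -> T) : lasso q g 0 = q 0.
Proof. exact: path_mul0. Qed.

Lemma lasso1 (R : realType) (T : Type) (q g : R -> T) : lasso q g 1 = q 0.
Proof. by rewrite /lasso !path_mul1 /path_inv subrr. Qed.

Lemma path_mul_sub (R : realType) (T : Type) (A : set T) (g g' : R -> T) :
  (forall s, 0 <= s <= 1 -> A (g s)) -> (forall s, 0 <= s <= 1 -> A (g' s)) ->
  forall s, 0 <= s <= 1 -> A (path_mul g g' s).
Proof.
move=> Ag Ag' s /andP[s0 s1]; rewrite /path_mul.
case: ifP => [s2|/negbT]; last rewrite -ltNge => s2.
  by apply: Ag; apply/andP; split; lra.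
by apply: Ag'; apply/andP; split; lra.
Qed.

Lemma path_inv_sub (R : realType) (T : Type) (A : set T) (g : R -> T) :
  (forall s, 0 <= s <= 1 -> A (g s)) ->
  forall s, 0 <= s <= 1 -> A (path_inv g s).
Proof. by move=> Ag s /andP[s0 s1]; apply: Ag; apply/andP; split; lra. Qed.

Lemma lasso_sub (R : realType) (T : Type) (A : set T) (q g : R -> T) :
  (forall s, 0 <= s <= 1 -> A (q s)) -> (forall s, 0 <= s <= 1 -> A (g s)) ->
  forall s, 0 <= s <= 1 -> A (lasso q g s).
Proof.
by move=> Aq Ag; apply: path_mul_sub => //; apply: path_mul_sub => //;
  exact: path_inv_sub.
Qed.

Lemma continuous_path_inv (R : realType) (T : topologicalType) (g : R -> T) :
  continuous g -> continuous (path_inv g).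
Proof.
move=> cg; apply: (@continuous_fun_comp _ _ _ (fun s : R => 1 - s)) => //.
by apply: (@continuous_fun_sub R R R) => s; [exact: cst_continuous|exact: cvg_id].
Qed.

(** Clamping both parameters to [0, 1] on the side of the junction replaces the case distinction by
    a sum: while one summand moves, the other rests at the common point [g 1 = g' 0], which is
    subtracted. The sum is why the target is a normed module. *)
Lemma continuous_path_mul (R : realType) (V : normedModType R) (g g' : R -> V) :
  continuous g -> continuous g' -> g 1 = g' 0 -> continuous (path_mul g g').
Proof.
move=> cg cg' gg'.
have -> : path_mul g g' =
    fun s => g (Num.min 1 (2 * s)) + g' (Num.max 0 (2 * s - 1)) - g 1.
  apply/funext => s; rewrite /path_mul.
  case: ifP => [s2|/negbT]; last rewrite -ltNge => s2.
    by rewrite min_r ?max_l ?gg' ?addrK//; lra.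
  by rewrite min_l ?max_r// 1?addrAC ?subrr ?add0r//; lra.
have cst (k : R) : continuous (fun _ : R => k) by exact: cst_continuous.
have c2 : continuous (fun s : R => 2 * s).
  by apply: continuous_fun_mul => // s; exact: cvg_id.
apply: continuous_fun_sub; last exact: cst_continuous.
apply: continuous_fun_add.
  by apply: continuous_fun_comp => //; exact: continuous_fun_min.
apply: continuous_fun_comp => //; apply: continuous_fun_max => //.
exact: (@continuous_fun_sub R R R).
Qed.

Lemma continuous_lasso (R : realType) (V : normedModType R) (q g : R -> V) :
  continuous q -> continuous g -> q 1 = g 0 -> g 1 = q 1 ->
  continuous (lasso q g).
Proof.
move=> cq cg qg gq; apply: continuous_path_mul; rewrite ?path_mul0//.
apply: continuous_path_mul => //; first exact: continuous_path_inv.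
by rewrite /path_inv subr0.
Qed.

(** * Coordinates, legs and loops of the standard pair of pants *)

Lemma ord3_cycle (i : 'I_3) :
  [/\ ordS i != i, ord_pred i != i, ord_pred i != ordS i &
      forall j, [|| j == i, j == ordS i | j == ord_pred i]].
Proof.
by case: i => -[|[|[|//]]] ?; split=> // -[[|[|[|//]]] ?].
Qed.

Section AxisPoint.
Context {R : realType}.
Implicit Types (i j k : 'I_3) (x y : 'rV[R]_3) (h a b s u : R).

Lemma axis_point_axis i h a b : axis_point i h a b 0 i = h.
Proof. by rewrite mxE eqxx. Qed.

Lemma axis_point_ordS i h a b : axis_point i h a b 0 (ordS i) = a.
Proof. by rewrite mxE eqxx; case: (ord3_cycle i) => /negbTE->. Qed.

Lemma axis_point_pred i h a b : axis_point i h a b 0 (ord_pred i) = b.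
Proof.
by rewrite mxE; case: (ord3_cycle i) => _ /negbTE-> /negbTE->.
Qed.

Lemma rV3P i x y : x 0 i = y 0 i -> x 0 (ordS i) = y 0 (ordS i) ->
  x 0 (ord_pred i) = y 0 (ord_pred i) -> x = y.
Proof.
move=> xy0 xy1 xy2; apply/rowP => j.
by have [_ _ _ /(_ j)/or3P[]/eqP->] := ord3_cycle i.
Qed.

Lemma sum_ord3_cycle i (F : 'I_3 -> R) :
  \sum_j F j = F i + F (ordS i) + F (ord_pred i).
Proof.
have [Si pi piS all3] := ord3_cycle i.
rewrite (bigD1 i)//= (bigD1 (ordS i))//= (bigD1 (ord_pred i))/= ?pi ?piS//.
rewrite big_pred0 ?addr0 ?addrA// => j.
apply/negP => /andP[/andP[/negbTE ji /negbTE jS] /negbTE jp].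
by move: (all3 j); rewrite ji jS jp.
Qed.

Lemma std_pantsP i x : std_pants x <->
  [/\ x 0 i ^+ 2 + x 0 (ordS i) ^+ 2 + x 0 (ord_pred i) ^+ 2 = 1,
      x 0 i <= 4 / 5, x 0 (ordS i) <= 4 / 5 & x 0 (ord_pred i) <= 4 / 5].
Proof.
rewrite /std_pants/= (sum_ord3_cycle i); split=> [[-> le]|[-> xi xS xp]]//.
by split=> // j; have [_ _ _ /(_ j)/or3P[]/eqP->] := ord3_cycle i.
Qed.

Lemma continuous_axis_point (T : topologicalType) i (h a b : T -> R) :
  continuous h -> continuous a -> continuous b ->
  continuous (fun t => axis_point i (h t) (a t) (b t)).
Proof.
move=> ch ca cb; apply: continuous_mx => k j.
rewrite (_ : (fun t => _) = if j == i then h else if j == ordS i then a else b).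
  by do 2 case: ifP => // _.
by apply/funext => t; rewrite mxE; do 2 case: ifP => // _.
Qed.

(** On the cuff [j] the two other coordinates have squares of sum 1 - 16/25 = 9/25. The bound 3/5
    lies below 7/10, where the collar of the twist begins. *)
Lemma std_cuff_other i j x : std_cuff j x -> i != j -> x 0 i <= 3 / 5.
Proof.
move=> [/(std_pantsP j)[n1 _ _ _] /= xj] ij.
rewrite xj in n1.
have [_ _ _ /(_ i)/or3P[]/eqP ei] := ord3_cycle j; last 2 first.
- by rewrite ei; nra.
- by rewrite ei; nra.
- by rewrite ei eqxx in ij.
Qed.

Lemma cos_pi4 : cos (pi / 4) = (Num.sqrt 2)^-1 :> R.
Proof.
have c0 : 0 < cos (pi / 4 : R).
  by apply: cos_gt0_pihalf; have := @pi_gt0 R; move=> ?; apply/andP; split; lra.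
(* As cos (pi / 2) = 0, the squares of the cosine and the sine of pi / 4 are equal, and their sum is
   1. *)
have c2 : cos (pi / 4 : R) ^+ 2 = 2^-1.
  have := @cos_pihalf R; rewrite (_ : pi / 2 = pi / 4 + pi / 4); last by field.
  have := cos2Dsin2 (pi / 4 : R).
  by rewrite cosD -!expr2; lra.
by rewrite -sqrtrV ?ler0n// -c2 sqrtr_sqr gtr0_norm.
Qed.

Lemma sin_pi4 : sin (pi / 4) = (Num.sqrt 2)^-1 :> R.
Proof.
by rewrite -cos_pi4 -cosBpihalf (_ : pi / 4 - pi / 2 = - (pi / 4)) ?cosN//; field.
Qed.

Lemma cuff_loop_std_cuff i s : std_cuff i (cuff_loop i s).
Proof.
rewrite /cuff_loop; set th := pi / 4 + _.
split; last by rewrite /= axis_point_axis.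
apply/(std_pantsP i).
rewrite axis_point_axis axis_point_ordS axis_point_pred.
have := cos2Dsin2 th; have := cos_le1 th; have := sin_le1 th => *.
by split; nra.
Qed.

Lemma cuff_loop1 i : cuff_loop i 1 = cuff_loop i 0 :> 'rV[R]_3.
Proof.
rewrite /cuff_loop mulr0 addr0 mulr1.
have -> : pi / 4 + 2 * pi = pi / 4 + pi *+ 2 :> R by rewrite mulr_natl.
by rewrite cosD2pi sinD2pi.
Qed.

Lemma continuous_cuff_loop i : continuous (@cuff_loop R i).
Proof.
have cst (k : R) : continuous (fun _ : R => k) by exact: cst_continuous.
have cth : continuous (fun s : R => pi / 4 + 2 * pi * s).
  apply: (@continuous_fun_add R R R) => //.
  by apply: continuous_fun_mul => // s; exact: cvg_id.
apply: continuous_axis_point => //; apply: continuous_fun_mul => //.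
- by apply: continuous_fun_comp => //; exact: continuous_cos.
- by apply: continuous_fun_comp => //; exact: continuous_sin.
Qed.

Lemma std_leg0 i : std_leg i 0 = std_center R.
Proof.
have s3 : (Num.sqrt 3)^-1 ^+ 2 = 3^-1 :> R.
  by rewrite exprVn sqr_sqrtr// ler0n.
have w : Num.sqrt ((1 - (Num.sqrt 3)^-1 ^+ 2) / 2) = (Num.sqrt 3)^-1 :> R.
  rewrite s3 (_ : (1 - 3^-1) / 2 = 3^-1); last by field.
  by rewrite sqrtrV ?ler0n.
rewrite /std_leg subr0 mul1r mul0r addr0 w.
by apply: (rV3P i);
  rewrite ?axis_point_axis ?axis_point_ordS ?axis_point_pred !mxE.
Qed.

(** At height 4/5 the two equal coordinates of the leg are 3/5 times the cosine and sine of pi / 4,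
    the angle at which [cuff_loop] starts. *)
Lemma std_leg1 i : std_leg i 1 = cuff_loop i 0 :> 'rV[R]_3.
Proof.
rewrite /std_leg /cuff_loop subrr mul0r add0r mul1r mulr0 addr0 cos_pi4 sin_pi4.
suff -> : Num.sqrt ((1 - (4 / 5) ^+ 2) / 2) = 3 / 5 * (Num.sqrt 2)^-1 :> R by [].
rewrite (_ : (1 - (4 / 5) ^+ 2) / 2 = (3 / 5) ^+ 2 * 2^-1); last by field.
by rewrite sqrtrM ?sqr_ge0// sqrtr_sqr sqrtrV ?ler0n// ger0_norm//; lra.
Qed.

Lemma std_leg_std_pants i s : 0 <= s <= 1 -> std_pants (@std_leg R i s).
Proof.
move=> /andP[s0 s1].
have r3 : (Num.sqrt 3)^-1 ^+ 2 = 3^-1 :> R.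
  by rewrite exprVn sqr_sqrtr// ler0n.
have r0 : 0 < (Num.sqrt 3)^-1 :> R by rewrite invr_gt0 sqrtr_gt0.
rewrite /std_leg; set r := (Num.sqrt 3)^-1 in r3 r0 *.
set h := _ + _; set w := Num.sqrt _.
(* The height [h] stays between 1/sqrt 3 and 4/5, so that [w ^+ 2] is at most (1 - 1/3) / 2 = 1/3
   and no coordinate exceeds 4/5. *)
have rle : r <= 4 / 5 by nra.
have hge : r <= h by rewrite /h; nra.
have hle : h <= 4 / 5 by rewrite /h; nra.
have w0 : 0 <= w by exact: sqrtr_ge0.
have w2 : w ^+ 2 = (1 - h ^+ 2) / 2 by rewrite sqr_sqrtr//; nra.
apply/(std_pantsP i).
rewrite axis_point_axis axis_point_ordS axis_point_pred.
by split; nra.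
Qed.

Lemma continuous_std_leg i : continuous (@std_leg R i).
Proof.
have cst (k : R) : continuous (fun _ : R => k) by exact: cst_continuous.
have ci : continuous (fun s : R => s) by move=> s; exact: cvg_id.
have ch : continuous (fun s : R => (1 - s) / Num.sqrt 3 + s * (4 / 5)).
  apply: (@continuous_fun_add R R R); apply: continuous_fun_mul => //.
  exact: (@continuous_fun_sub R R R).
have cw : continuous (fun s : R =>
    Num.sqrt ((1 - ((1 - s) / Num.sqrt 3 + s * (4 / 5)) ^+ 2) / 2)).
  (* For [s] outside [0, 1] the radicand may be negative; [Num.sqrt] is 0 there and remains
     continuous on the whole line. *)
  apply: continuous_fun_comp; last exact: sqrt_continuous.
  apply: continuous_fun_mul => //; apply: (@continuous_fun_sub R R R) => //.
  exact: (@continuous_fun_mul R R).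
exact: continuous_axis_point.
Qed.

Lemma std_loop_std_pants i k s : 0 <= s <= 1 -> std_pants (@std_loop R i k s).
Proof.
move: s; apply: lasso_sub => s s01; last by case: (cuff_loop_std_cuff k s).
by apply: path_mul_sub s01; [apply: path_inv_sub|]; exact: std_leg_std_pants.
Qed.

Lemma continuous_std_loop i k : continuous (@std_loop R i k).
Proof.
apply: continuous_lasso.
- apply: continuous_path_mul; last by rewrite /path_inv subrr !std_leg0.
    exact/continuous_path_inv/continuous_std_leg.
  exact: continuous_std_leg.
- exact: continuous_cuff_loop.
- by rewrite path_mul1 std_leg1.
- by rewrite path_mul1 std_leg1 cuff_loop1.
Qed.

Lemma std_loop0 i k : std_loop i k 0 = cuff_loop i 0 :> 'rV[R]_3.
Proof. by rewrite /std_loop lasso0 path_mul0 /path_inv subr0 std_leg1. Qed.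

Lemma std_loop1 i k : std_loop i k 1 = cuff_loop i 0 :> 'rV[R]_3.
Proof. by rewrite /std_loop lasso1 path_mul0 /path_inv subr0 std_leg1. Qed.

(** * A homotopy from the identity to the twist *)

Definition partial_twist i u x : 'rV[R]_3 :=
  let th := u * (2 * pi * Num.max 0 (10 * x 0 i - 7)) in
  let a := x 0 (ordS i) in
  let b := x 0 (ord_pred i) in
  axis_point i (x 0 i) (cos th * a - sin th * b) (sin th * a + cos th * b).

Lemma partial_twist1 i x : partial_twist i 1 x = std_twist i x.
Proof. by rewrite /partial_twist mul1r. Qed.

Lemma partial_twist_id i u x :
  u * (2 * pi * Num.max 0 (10 * x 0 i - 7)) = 0 -> partial_twist i u x = x.
Proof.
rewrite /partial_twist => ->; rewrite cos0 sin0 !mul1r !mul0r subr0 add0r.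
by apply: (rV3P i); rewrite ?axis_point_axis ?axis_point_ordS ?axis_point_pred.
Qed.

Lemma partial_twist0 i x : partial_twist i 0 x = x.
Proof. by apply: partial_twist_id; rewrite mul0r. Qed.

Lemma partial_twist_outside i u x : x 0 i <= 7 / 10 -> partial_twist i u x = x.
Proof.
by move=> xi; apply: partial_twist_id; rewrite max_l ?mulr0//; lra.
Qed.

Lemma partial_twist_other_cuff i j u x :
  std_cuff j x -> i != j -> partial_twist i u x = x.
Proof.
move=> xj ij; apply: partial_twist_outside.
by have := std_cuff_other _ _ _ xj ij; lra.
Qed.

(** The cuff [i] is rotated by a full turn; the other cuffs do not meet the collar. *)
Lemma std_twist_cuff i j x : std_cuff j x -> std_twist i x = x.
Proof.
move=> xj; have [ij|ij] := eqVneq i j; last first.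
  by rewrite -partial_twist1; exact: partial_twist_other_cuff xj ij.
case: xj => _; rewrite -ij /= /std_twist => xi.
have -> : Num.max 0 (10 * x 0 i - 7) = 1 by rewrite xi max_r; lra.
rewrite mulr1 mulr_natl cos2pi sin2pi !mul1r !mul0r subr0 add0r.
by apply: (rV3P i); rewrite ?axis_point_axis ?axis_point_ordS ?axis_point_pred.
Qed.

(** On the cuff [i] the collar factor equals 1, so the rotation angle is [2 * pi * u], the angle
    covered by [cuff_loop] up to time [u]. Hence the base point traces the pants curve once, with
    the hole on the left. *)
Lemma partial_twist_cuff_loop i u :
  partial_twist i u (cuff_loop i 0) = cuff_loop i u.
Proof.
rewrite /partial_twist /cuff_loop.
rewrite axis_point_axis axis_point_ordS axis_point_pred mulr0 addr0.
have -> : Num.max 0 (10 * (4 / 5) - 7) = 1 :> R by rewrite max_r; lra.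
rewrite mulr1 [u * _]mulrC; set th := 2 * pi * u; set a := pi / 4.
by congr axis_point; rewrite ?cosD ?sinD; ring.
Qed.

(** The rotation acts only where [x 0 i] exceeds 7/10. There it preserves [a ^+ 2 + b ^+ 2], which
    is less than 51/100, so the rotated coordinates stay below 4/5 and no other cap is entered. *)
Lemma partial_twist_std_pants i u x :
  std_pants x -> std_pants (partial_twist i u x).
Proof.
move=> xP; have [xi|xi] := leP (x 0 i) (7 / 10).
  by rewrite partial_twist_outside.
move: xP => /(std_pantsP i)[n1 x0 _ _]; apply/(std_pantsP i).
rewrite /partial_twist; set th := u * _.
rewrite axis_point_axis axis_point_ordS axis_point_pred.
set a := x 0 (ordS i) in n1 *; set b := x 0 (ord_pred i) in n1 *.
set a' := _ - _; set b' := sin th * a + _.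
have ab : a' ^+ 2 + b' ^+ 2 = a ^+ 2 + b ^+ 2.
  rewrite -[RHS]mul1r -(cos2Dsin2 th) /a' /b'; ring.
split=> //; first by rewrite -addrA ab addrA.
- by nra.
- by nra.
Qed.

Lemma continuous_partial_twist (T : topologicalType) i (u : T -> R)
    (g : T -> 'rV[R]_3) :
  continuous u -> continuous g ->
  continuous (fun t => partial_twist i (u t) (g t)).
Proof.
move=> cu cg.
have cst (k : R) : continuous (fun _ : T => k) by exact: cst_continuous.
have cx j : continuous (fun t => g t 0 j).
  apply: (@continuous_fun_comp _ _ _ g (fun x => x 0 j)) => //.
  exact: coord_continuous.
have cth : continuous (fun t => u t * (2 * pi * Num.max 0 (10 * g t 0 i - 7))).
  apply: continuous_fun_mul => //; apply: continuous_fun_mul => //.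
  apply: continuous_fun_max => //; apply: (@continuous_fun_sub R T R) => //.
  exact: continuous_fun_mul.
have cc := continuous_fun_comp _ _ _ _ _ cth (@continuous_cos R).
have cs := continuous_fun_comp _ _ _ _ _ cth (@continuous_sin R).
apply: continuous_axis_point => //.
  by apply: (@continuous_fun_sub R T R); exact: continuous_fun_mul.
by apply: (@continuous_fun_add R T R); exact: continuous_fun_mul.
Qed.

End AxisPoint.

(** * Linear algebra of the twist condition *)

Section TwistCondition.
Context {C : numClosedFieldType}.
Implicit Types (A B P : 'M[C]_2) (x y : 'cV[C]_2) (e l t : C).

(* [twist_condition], for the matrices of gamma_1, gamma_2, gamma_5 and the
   eigenvalues at the fixed points. *)
Definition matrix_twist_condition A B2 B5 e e2 e5 t : Prop :=
  t != 0 /\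
  exists (M : 'M[C]_2) (x1 y1 x2 x5 : 'cV[C]_2),
    [/\ eigenvector A e x1, eigenvector A e^-1 y1,
        eigenvector B2 e2 x2 & eigenvector B5 e5 x5] /\
    [/\ M *m x1 = sqrtC (- t) *: x1,
        M *m y1 = (sqrtC (- t))^-1 *: y1 &
        same_point (M *m x2) x5].

Lemma eigenvalue_neq0 A e x : A \in unitmx -> eigenvector A e x -> e != 0.
Proof.
move=> uA [x0]; apply: contra_eqN => /eqP->; rewrite scale0r.
by apply: contra_neq x0 => Ax; rewrite -(mulKmx uA x) Ax mulmx0.
Qed.

Lemma eigenvector_inv A e x :
  A \in unitmx -> eigenvector A e x -> invmx A *m x = e^-1 *: x.
Proof.
move=> uA ex; have e0 := eigenvalue_neq0 _ _ _ uA ex; case: ex => _ Ax.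
by apply: (scalerI e0); rewrite scalerA divff// scale1r scalemxAr -Ax mulKmx.
Qed.

(** This moves a fixed point of [B] to one of [B'] by [invmx P], and also lets the roles of [B] and
    [B'] be exchanged. *)
Lemma conj_invmx B B' P : P \in unitmx -> B *m P = P *m B' ->
  B' *m invmx P = invmx P *m B.
Proof.
move=> uP BP; apply: (can_inj (mulKmx uP)).
by rewrite mulmxA -BP mulmxK// mulKVmx.
Qed.

(** [sqrtC] is a fixed choice of square root, hence multiplicative only up to a sign [c]. *)
Lemma sqrtC_sqrM l t : exists2 c : C, c ^+ 2 = 1 &
  sqrtC (l ^+ 2 * t) = c * (l * sqrtC t).
Proof.
have := sqrtCK (l ^+ 2 * t).
rewrite -{2}(sqrtCK t) -exprMn => /eqP; rewrite eqf_sqr => /orP[]/eqP->.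
  by exists 1; rewrite ?expr1n ?mul1r.
by exists (-1); rewrite ?sqrr_sign ?mulN1r// sqrrN expr1n.
Qed.

(* If P has eigenvalues l and 1/l at x_1 and y_1, then +-M P has the square root
   of -l^2 t as eigenvalue at x_1, and it sends P^-1 x_2 to x_5. *)
Lemma matrix_twist_condition_conj A B2 B2' B5 P e e2 e5 l t :
  P \in unitmx -> l != 0 -> B2 *m P = P *m B2' ->
  (forall x, eigenvector A e x -> P *m x = l *: x) ->
  (forall y, eigenvector A e^-1 y -> P *m y = l^-1 *: y) ->
  matrix_twist_condition A B2 B5 e e2 e5 t ->
  matrix_twist_condition A B2' B5 e e2 e5 (l ^+ 2 * t).
Proof.
move=> uP l0 BP Px Py.
move=> [t0 [M [x1 [y1 [x2 [x5 [[ex ey [x20 e2x] ez] [Mx My M2]]]]]]]].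
split; first by rewrite mulf_neq0 ?expf_neq0.
have [c c2 ct] := sqrtC_sqrM l (- t).
(* The sign is its own inverse, so one factor [c] corrects the eigenvalues at both [x1] and [y1]. *)
have cV : c^-1 = c.
  have c0 : c != 0 by rewrite -sqrf_eq0 c2 oner_eq0.
  by apply: (mulfI c0); rewrite divff// -expr2.
exists (c *: (M *m P)), x1, y1, (invmx P *m x2), x5; split; split => //.
- split.
    by apply: contra_neq x20 => Px2; rewrite -(mulKVmx uP x2) Px2 mulmx0.
  by rewrite mulmxA (conj_invmx _ _ _ uP BP) -mulmxA e2x scalemxAr.
- by rewrite -mulrN ct -scalemxAl -mulmxA Px// -scalemxAr Mx !scalerA mulrA.
- rewrite -mulrN ct -scalemxAl -mulmxA Py// -scalemxAr My !scalerA !invfM cV.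
  by rewrite mulrA.
(* The new matrix sends [invmx P *m x2] to [c *: (M *m x2)], and the factor [c] cancels against the
   one in [c * d]. *)
- case: M2 => d d0 ->; exists (c * d).
    by rewrite mulf_neq0// -sqrf_eq0 c2 oner_eq0.
  by rewrite -scalemxAl -mulmxA mulKVmx// scalerA mulrAC -expr2 c2 mul1r.
Qed.

(** Conjugation by [A] multiplies solutions by [e ^+ 2], and conjugation by its inverse divides them
    by it. The two solution sets are thus in bijection, and uniqueness passes from one to the
    other. *)
Lemma unique_twist_parameter_conj A B2 B2' B5 e e2 e5 t : \det A = 1 ->
  B2 *m A = A *m B2' ->
  unique (matrix_twist_condition A B2 B5 e e2 e5) t ->
  forall t', unique (matrix_twist_condition A B2' B5 e e2 e5) t' <->
    t' = e ^+ 2 * t.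
Proof.
move=> detA BA [tt tu] t'.
have uA : A \in unitmx by rewrite unitmxE detA unitr1.
(* The given solution [t] comes with an eigenvector of the invertible matrix [A] for [e]. *)
have e0 : e != 0.
  by case: tt => _ [M [x1 [y1 [x2 [x5 [[/(eigenvalue_neq0 _ _ _ uA)]]]]]]].
have fwd s : matrix_twist_condition A B2 B5 e e2 e5 s ->
    matrix_twist_condition A B2' B5 e e2 e5 (e ^+ 2 * s).
  by apply: matrix_twist_condition_conj uA e0 BA _ _ => x [].
have BAV := conj_invmx _ _ _ uA BA.
(* The same implication is applied with [P := invmx A] and [l := e^-1], the matrices [B2] and [B2']
   being exchanged. *)
have bwd s : matrix_twist_condition A B2' B5 e e2 e5 s ->
    matrix_twist_condition A B2 B5 e e2 e5 (e^-1 ^+ 2 * s).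
  apply: matrix_twist_condition_conj BAV _ _; rewrite ?unitmx_inv ?invr_eq0//;
    by move=> x; exact: eigenvector_inv.
have sol s : matrix_twist_condition A B2' B5 e e2 e5 s -> s = e ^+ 2 * t.
  by move=> /bwd/tu ->; rewrite mulrA -exprMn divff// expr1n mul1r.
split=> [[/sol]//|->]; split; first exact: fwd.
by move=> s /sol.
Qed.
End TwistCondition.

(** * Effect of the Dehn twist on loops and parameters *)

Section Twist.
Context {R : realType} {S : topologicalType}.
Implicit Types (D : pants_marking R S).

(** Intermediate stages rotate the cuff of [f] but no other cuff, so they need not match across the
    pants curve; each homotopy below stays within a single chart. *)
Definition partial_chart D (f : half_edge D) (v : vertex D) (u : R)
    (x : 'rV[R]_3) : S :=
  if v == f.1 then chart v (partial_twist f.2 u x) else chart v x.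

Lemma partial_chart0 D (f : half_edge D) v x :
  partial_chart D f v 0 x = chart v x.
Proof. by rewrite /partial_chart partial_twist0 if_same. Qed.

Lemma partial_chart1 D (f : half_edge D) v x :
  partial_chart D f v 1 x = @chart R S (right_dehn_twist f) v x.
Proof. by rewrite /partial_chart partial_twist1. Qed.

(** If [h] lies in the pair of pants of [f], it is another leg of it, and its cuff avoids the
    collar. This covers a pants curve with the same pair of pants on both sides. *)
Lemma partial_chart_cuff D (f h : half_edge D) u x :
  h != f -> std_cuff h.2 x -> partial_chart D f h.1 u x = chart h.1 x.
Proof.
rewrite /partial_chart => hf hx; case: eqP => // h1.
rewrite (partial_twist_other_cuff _ _ _ _ hx)//.
apply: contra_neq hf => h2.
by rewrite [h]surjective_pairing h1 -h2 -surjective_pairing.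
Qed.

Lemma continuous_partial_chart D (f : half_edge D) v (g : R -> 'rV[R]_3) :
  {within @std_pants R, continuous (chart v)} ->
  continuous g -> (forall s, 0 <= s <= 1 -> std_pants (g s)) ->
  {within `[0, 1] `*` `[0, 1],
    continuous (fun p : R * R => partial_chart D f v p.2 (g p.1))}.
Proof.
move=> cv cg gP.
have cf : continuous (fun p : R * R => g p.1).
  apply: (@continuous_fun_comp _ _ _ (fun p : R * R => p.1)) => // p.
  exact: cvg_fst.
rewrite /partial_chart; case: (v == f.1).
  apply: (continuous_within_comp _ _ _ _ (@std_pants R)
    (fun p : R * R => partial_twist f.2 p.2 (g p.1))) => //.
    by apply: continuous_partial_twist => // p; exact: cvg_snd.
  move=> [s u] [/= + _]; rewrite in_itv/= => /gP.
  exact: partial_twist_std_pants.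
apply: (continuous_within_comp _ _ _ _ (@std_pants R)
  (fun p : R * R => g p.1)) => //.
by move=> [s u] [/= + _]; rewrite in_itv/= => /gP.
Qed.

Lemma right_dehn_twist_curve_loop D (f h : half_edge D) :
  @curve_loop R S (right_dehn_twist f) h = curve_loop h.
Proof.
apply/funext => s; rewrite /curve_loop /=.
by rewrite (std_twist_cuff _ _ _ (cuff_loop_std_cuff _ s)) if_same.
Qed.

Lemma right_dehn_twist_pants_curve D (f h : half_edge D) :
  @pants_curve R S (right_dehn_twist f) h = pants_curve h.
Proof.
by apply: eq_imagel => x xh; rewrite /= (std_twist_cuff _ _ _ xh) if_same.
Qed.

Lemma right_dehn_twist_oriented_parameter D (f h : half_edge D) ev :
  @oriented_parameter R S (right_dehn_twist f) ev h = oriented_parameter ev h.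
Proof. by rewrite /oriented_parameter right_dehn_twist_pants_curve. Qed.

(** The gluing reverses the parameter and sends 0 to 1, where the loop on the other side closes
    up. *)
Lemma crossing_glue D (f : half_edge D) :
  decomposed_surface D -> interior_edge f ->
  crossing (Defs.glue f) = crossing f.
Proof.
move=> [_ _ _ + _] fi => /(_ f fi)[g [_ _ g0 _ /(_ 0)]].
rewrite lexx ler01 g0 => /(_ isT); rewrite /crossing => ->.
by rewrite /curve_loop /= cuff_loop1.
Qed.

Lemma curve_loop_is_loop D (f : half_edge D) :
  decomposed_surface D -> is_loop (crossing f) (curve_loop f).
Proof.
move=> [_ _ [cv _] _ _]; split=> //; last first.
  by rewrite /crossing/curve_loop /= cuff_loop1.
apply: continuous_within_comp (@continuous_cuff_loop R f.2) _ (cv f.1) => s _.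
by case: (cuff_loop_std_cuff f.2 s).
Qed.

Variables (D : pants_marking R S) (f : half_edge D).
Variable rho : (R -> S) -> 'M[complex R]_2.
Hypotheses (surfD : decomposed_surface D) (fi : interior_edge f).
Hypothesis rhoP : SL2_representation (crossing f) rho.

(** The partial twists deform the loop while both its ends run along [curve_loop f]. The commutation
    form expresses conjugation by gamma1 without inverses. *)
Lemma right_dehn_twist_vertex_loop (k : 'I_3) :
  rho (vertex_loop f k) *m rho (curve_loop f) =
  rho (curve_loop f) *m rho (@vertex_loop R S (right_dehn_twist f) f k).
Proof.
have [_ _ [cv _] _ _] := surfD.
have lc := curve_loop_is_loop _ f surfD.
have [|s|s|u|u|_ _ conj] := representation_free_homotopy _ _ _ rho
  (fun p => partial_chart D f f.1 p.2 (std_loop f.2 k p.1))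
  (vertex_loop f k) (@vertex_loop R S (right_dehn_twist f) f k) (curve_loop f)
  rhoP _ _ _ _ _ lc.
- apply: continuous_partial_chart; first exact: cv.
    exact: continuous_std_loop.
  exact: std_loop_std_pants.
- exact: partial_chart0.
- exact: partial_chart1.
- by rewrite /= std_loop0 /partial_chart eqxx partial_twist_cuff_loop.
- by rewrite /= std_loop1 /partial_chart eqxx partial_twist_cuff_loop.
- exact: conj.
Qed.

Lemma right_dehn_twist_opposite_vertex_loop (k : 'I_3) :
  rho (@vertex_loop R S (right_dehn_twist f) (Defs.glue f) k) =
  rho (vertex_loop (Defs.glue f) k).
Proof.
have [_ _ [cv _] _ _] := surfD; have [_ rhoh _] := rhoP.
have : path_homotopic (crossing f) (crossing f) (vertex_loop (Defs.glue f) k)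
    (@vertex_loop R S (right_dehn_twist f) (Defs.glue f) k).
  exists (fun p =>
    partial_chart D f (Defs.glue f).1 p.2 (std_loop (Defs.glue f).2 k p.1)).
  split => [|s _|s _|u _] /=.
  - apply: continuous_partial_chart; first exact: cv.
      exact: continuous_std_loop.
    exact: std_loop_std_pants.
  - exact: partial_chart0.
  - exact: partial_chart1.
  - have cross := crossing_glue _ _ surfD fi.
    rewrite std_loop0 std_loop1.
    rewrite (partial_chart_cuff _ _ _ _ _ fi (cuff_loop_std_cuff _ _)).
    exact: (conj cross cross).
move=> hom; have [l l'] := path_homotopic_is_path _ _ _ _ _ _ hom.
by rewrite (rhoh _ _ l l' hom).
Qed.

End Twist.

Theorem proposition10p6 (R : realType) (S : topologicalType)
    (D : pants_marking R S) (f : half_edge D)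
    (rho : (R -> S) -> 'M[complex R]_2) (ev : set S -> complex R)
    (e t : complex R) :
  decomposed_surface D ->
  euler_characteristic D < 0 ->
  interior_edge f -> outgoing f ->
  SL2_representation (crossing f) rho ->
  curves_have_two_fixed_points D (crossing f) rho ->
  irreducible_on_pants D (crossing f) rho ->
  eigenvalue_parameters D (crossing f) rho ev ->
  edge_parameters D rho ev f (e, t) ->
  forall p : complex R * complex R,
    edge_parameters (right_dehn_twist f) rho ev f p <->
    p = (e, e ^+ 2 * t).
Proof.
move=> surfD _ fi _ rhoP _ _ _ [/= -> tt] [e' t'].
have [det_rho _ _] := rhoP.
have detA := det_rho _ (curve_loop_is_loop _ _ surfD).
have uniqE := unique_twist_parameter_conj _ _ _ _ _ _ _ _ detA
  (right_dehn_twist_vertex_loop _ _ _ surfD rhoP (ordS f.2)) tt.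
rewrite /edge_parameters /twist_parameter.
(* After the twist only the matrix of gamma2 is new; gamma1, the image of gamma5 and all eigenvalue
   parameters are those of [D]. *)
have -> : @twist_condition R S (right_dehn_twist f) rho ev f =
    matrix_twist_condition (rho (curve_loop f))
      (rho (@vertex_loop R S (right_dehn_twist f) f (ordS f.2)))
      (rho (vertex_loop (Defs.glue f) (ord_pred (Defs.glue f).2)))
      (ev (pants_curve f))
      (oriented_parameter ev ((f.1, ordS f.2) : half_edge D))
      (oriented_parameter ev
        (((Defs.glue f).1, ord_pred (Defs.glue f).2) : half_edge D)).
  rewrite -(right_dehn_twist_opposite_vertex_loop _ _ _ surfD fi rhoP).
  rewrite -(right_dehn_twist_curve_loop D f f).
  rewrite -(right_dehn_twist_pants_curve D f f).
  by rewrite -!(right_dehn_twist_oriented_parameter D f).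
rewrite right_dehn_twist_pants_curve /= uniqE.
by split=> [[-> ->]|[-> ->]].
Qed.
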